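(* Assume $w_i=1$ for all $i\in N$, and let $\alpha_{\mathrm{pes}}$ be the maximum cardinality of an independent set of the pessimistic interval graph $G_{\mathrm{pes}}$. Then there is a minimum clique cover of $G_{\mathrm{pes}}$, given by a set $\mathcal{J}\subseteq M$ with $|\mathcal{J}|=\alpha_{\mathrm{pes}}$ (the slot $k\in\mathcal{J}$ representing the clique $\{i\in N: k\in[a_i,d_i]\}$), such that for each task $i\in N$ there is exactly one $k\in\mathcal{J}$ with $k\in[a_i,d_i]$. Denote this unique element by $k_i$. Let $\alpha$ be the optimal value of the linear programming relaxation of CDSRSE $$\max\Bigl\{\sum_{i=1}^n w_ix_i:\ \sum_{i=1}^nP^o_{ik}x_i\le1\ \ \forall k\in M,\ x\ge 0\Bigr\}.$$ Then $\min_{i\in N}P^o_{ik_i}>0$ and $$\alpha\ \le\ \frac{1}{\min_{i\in N}P^o_{ik_i}}\,\alpha_{\mathrm{pes}}.$$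
   Context: Slots $M=[m]=\{1,\dots,m\}$, tasks $N=[n]$ with weights $w_i$. Each task $i\in N$ has independent random start time $s_i$ and end time $e_i$ in $M$ with discrete distributions having supports $S_i,E_i\subseteq M$, with $\max S_i\le\min E_i$. Put $a_i=\min S_i$, $d_i=\max E_i$, and $P^o_{ik}=\Pr[s_i\le k\le e_i]$, the probability that task $i$ occupies slot $k$. The pessimistic interval graph $G_{\mathrm{pes}}$ has vertex set $N$, with distinct $i,j$ adjacent iff the integer intervals $[a_i,d_i]$ and $[a_j,d_j]$ intersect. CDSRSE (conservative dynamic scheduling with random start and end times) is the problem of committing to tasks sequentially so as to maximize the expected total weight of scheduled tasks, where the start and end times of a task are realized when it is committed, every remaining task having a slot of its possible range $[a_j,d_j]$ occupied by a committed task is deleted, and the distributions of the other remaining tasks are not updated. In the linear program, $x_i$ represents the probability that task $i$ is scheduled.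
   Formalization: ''Exactly one k in J'' per task is false (ranges [1,1],[3,3],[1,3]); instead a minimum clique cover J with |J| = alpha_pes is shown to exist, and positivity and the bound hold for every such J and every choice of k_i in J lying in [a_i,d_i]. *)

(* Defs.v *)
From HB Require Import structures.
From mathcomp Require Import all_boot all_order all_algebra.
From mathcomp Require Import all_classical all_reals all_analysis.

Set Implicit Arguments.
Unset Strict Implicit.
Unset Printing Implicit Defensive.

Import Order.TTheory GRing.Theory Num.Theory.

Local Open Scope ring_scope.

(* The m slots are the elements of 'I_m, so the slot numbered k in {1, ..., m}
   is the ordinal of value k - 1; only the order of the slots matters. *)

Section Graphs.
Variables (V : finType) (G : rel V).

Definition independent (A : {set V}) : bool :=
  [forall i in A, forall j in A, ~~ G i j].

Definition independence_number : nat := \max_(A : {set V} | independent A) #|A|.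

Definition clique (A : {set V}) : bool :=
  [forall i in A, forall j in A, (i != j) ==> G i j].

Definition clique_cover (C : {set {set V}}) : bool :=
  [forall A in C, clique A] && (finset.cover C == [set: V]%SET).

Definition minimum_clique_cover (C : {set {set V}}) : bool :=
  clique_cover C &&
  [forall D : {set {set V}}, clique_cover D ==> (#|C| <= #|D|)%N].

End Graphs.

Section RandomSlots.
Context d (Omega : measurableType d) (R : realType) (P : probability Omega R).
Variable m : nat.
Implicit Types X Y : Omega -> 'I_m.

(* 'I_m carries no canonical measurableType structure; measurability for its
   discrete sigma-algebra amounts to measurability of the events X = k. *)
Definition slot_variable X : Prop :=
  forall k : 'I_m, measurable (X @^-1` [set k]%classic).

Definition independent_slots X Y : Prop :=
  forall k l : 'I_m,
    P (X @^-1` [set k] `&` Y @^-1` [set l])%classic =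
    (P (X @^-1` [set k])%classic * P (Y @^-1` [set l])%classic)%E.

Definition slot_support X : {set 'I_m} :=
  [set k : 'I_m | (0 < P (X @^-1` [set k])%classic)%E]%SET.

End RandomSlots.

(* The default value m is never reached on a nonempty set, and the support of a
   slot_variable is nonempty. *)
Definition min_slot m (A : {set 'I_m}) : nat := \big[minn/m]_(k in A) k.

Definition max_slot m (A : {set 'I_m}) : nat := \max_(k in A) k.

Section Tasks.
Context d (Omega : measurableType d) (R : realType) (P : probability Omega R).
Variables (n m : nat) (s e : 'I_n -> Omega -> 'I_m).

Definition earliest (i : 'I_n) : nat := min_slot (slot_support P (s i)).

Definition latest (i : 'I_n) : nat := max_slot (slot_support P (e i)).

Definition possible_range (i : 'I_n) : {set 'I_m} :=
  [set k : 'I_m | earliest i <= k <= latest i]%N%SET.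

Definition occupation (i : 'I_n) (k : 'I_m) : R :=
  fine (P [set t | (s i t <= k <= e i t)%N]%classic).

Definition pessimistic_graph : rel 'I_n :=
  fun i j => (i != j) && (possible_range i :&: possible_range j != finset.set0).

Definition slot_clique (k : 'I_m) : {set 'I_n} :=
  [set i : 'I_n | k \in possible_range i]%SET.

Definition lp_feasible (x : 'I_n -> R) : Prop :=
  (forall k : 'I_m, \sum_(i < n) occupation i k * x i <= 1) /\
  (forall i : 'I_n, 0 <= x i).

Definition lp_value (w : 'I_n -> R) : \bar R :=
  ereal_sup [set (\sum_(i < n) w i * x i)%:E | x in lp_feasible]%classic.

(* k_ assigns to every task one of the slots of a clique cover lying in its
   possible range; a wide range may contain several slots of the cover.
   An occupation probability is at most 1, so starting the minimum from 1
   does not change it as soon as n > 0. *)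
Definition min_occupation (k_ : 'I_n -> 'I_m) : R :=
  \big[Num.min/1]_(i < n) occupation i (k_ i).

End Tasks.

(* Main.v *)
(** The greedy right-endpoint rule on the ranges [a_i, d_i] produces an
    independent set together with equally many slots (the right endpoints of its
    members) that meet every range; independent sets never outnumber clique
    covers, so both are optimal. For the bound, P^o_{ik} is positive on the range
    of i because it dominates Pr[s_i = a_i] Pr[e_i = d_i]. Summing the constraints
    of the linear program over the slots of J, keeping in the constraint of k only
    the tasks with k_i = k, gives sum_i P^o_{i k_i} x_i <= |J|. *)
Require Import Defs.
From HB Require Import structures.
From mathcomp Require Import all_boot all_order all_algebra.
From mathcomp Require Import all_classical all_reals all_analysis.

Set Implicit Arguments.
Unset Strict Implicit.
Unset Printing Implicit Defensive.

Import Order.TTheory GRing.Theory Num.Theory.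
Local Open Scope ring_scope.

Lemma leq_independent_clique_cover (V : finType) (G : rel V)
    (A : {set V}) (D : {set {set V}}) :
  independent G A -> clique_cover G D -> (#|A| <= #|D|)%N.
Proof.
move=> /forall_inP indA /andP[/forall_inP cliqueD /eqP covD].
have inD i : finset.pblock D i \in D.
  by rewrite finset.pblock_mem // covD finset.in_setT.
have in_block i : i \in finset.pblock D i.
  by rewrite finset.mem_pblock covD finset.in_setT.
have inj : {in A &, injective (finset.pblock D)}.
  move=> i j iA jA eq_ij; apply/eqP; apply: contraT => neq_ij.
  have /forall_inP /(_ i (in_block i)) /forall_inP /(_ j) := cliqueD _ (inD i).
  rewrite {1}eq_ij in_block neq_ij => /(_ isT) /= Gij.
  by have /forall_inP /(_ j jA) := indA i iA; rewrite Gij.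
rewrite -(card_in_imset inj); apply: subset_leq_card.
by apply/fintype.subsetP => _ /imsetP[i _ ->].
Qed.

Lemma greedy_intervals (I : finType) (a b : I -> nat) (V : {set I}) :
  (forall i, (a i <= b i)%N) ->
  exists A : {set I},
    [/\ A \subset V,
        {in A &, forall i j, i != j -> (b i < a j)%N || (b j < a i)%N} &
        {in V, forall i, exists2 j, j \in A & (a i <= b j <= b i)%N}].
Proof.
move=> ab; have [N] := ubnP #|V|; elim: N V => // N IH V leVN.
have [->|/finset.set0Pn[i0 i0V]] := eqVneq V finset.set0.
  by exists finset.set0; split=> [|i j|i]; rewrite ?sub0set ?finset.in_set0.
case: (arg_minnP b i0V) => k kV' kmin; have {kV'} kV : k \in V by exact: kV'.
pose V' := [set i in V | b k < a i]%N%SET.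
have sV'V : V' \subset V by apply/fintype.subsetP => i; rewrite finset.inE => /andP[].
have kV' : k \notin V' by rewrite finset.inE kV /= -leqNgt ab.
have ltV' : (#|V'| < N)%N.
  rewrite ltnS in leVN; apply: leq_trans (proper_card _) leVN.
  by apply/properP; split=> //; exists k.
have [A' [sA'V' disjA' covA']] := IH V' ltV'.
have after i : i \in A' -> (b k < a i)%N.
  by move=> /(fintype.subsetP sA'V'); rewrite finset.inE => /andP[].
exists (k |: A')%SET; split.
- by rewrite finset.subUset finset.sub1set kV (fintype.subset_trans sA'V' sV'V).
- move=> i j /finset.setU1P[->|iA'] /finset.setU1P[->|jA'] neq_ij.
  + by rewrite eqxx in neq_ij.
  + by rewrite after.
  + by rewrite after // orbT.
  + exact: disjA'.
- move=> i iV; case: (ltnP (b k) (a i)) => [lt_ki|le_ik].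
    have iV' : i \in V' by rewrite finset.inE iV.
    by have [j jA' ?] := covA' i iV'; exists j; rewrite // finset.in_setU1 jA' orbT.
  by exists k; rewrite ?finset.setU11 // le_ik kmin.
Qed.

Lemma min_slot_le m (A : {set 'I_m}) k : k \in A -> (min_slot A <= k)%N.
Proof. exact: (@bigmin_le_cond _ nat _ m _ (mem A) (fun k : 'I_m => k : nat)). Qed.

Lemma min_slot_mem {m} {A : {set 'I_m}} :
  A != finset.set0 -> exists2 k : 'I_m, k \in A & k = min_slot A :> nat.
Proof.
move=> /finset.set0Pn[k0 k0A].
case: (arg_minnP (fun k : 'I_m => k : nat) k0A) => k kA kmin.
exists k => //; apply/eqP; rewrite eqn_leq min_slot_le // andbT.
rewrite /min_slot; elim/big_ind: _ => [|p q kp kq|i]; first exact: ltnW.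
- by rewrite leq_min kp.
- exact: kmin.
Qed.

Lemma max_slot_mem {m} {A : {set 'I_m}} :
  A != finset.set0 -> exists2 k : 'I_m, k \in A & k = max_slot A :> nat.
Proof.
move=> /finset.set0Pn[k0 k0A].
have Agt0 : (0 < #|A|)%N by apply/card_gt0P; exists k0.
by have [k kA maxE] := eq_bigmax_cond (fun k : 'I_m => k : nat) Agt0; exists k.
Qed.

Section SlotVariables.
Context d (Omega : measurableType d) (R : realType) (P : probability Omega R).
Variable m : nat.
Implicit Types X Y : Omega -> 'I_m.

Lemma slot_support_neq0 X : slot_variable X -> slot_support P X != finset.set0.
Proof.
move=> mX; apply: contraT; rewrite negbK => /eqP supp0.
have PX0 k : P (X @^-1` [set k])%classic = 0%E.
  apply/eqP; rewrite eq_le measure_ge0 andbT leNgt.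
  by have := finset.in_set0 k; rewrite -supp0 finset.inE => ->.
have : (P setT <= \sum_(k \in [set: 'I_m]) P (X @^-1` [set k])%classic)%E.
  apply: content_sub_fsum => //; first exact: finite_finset.
  by move=> t _; exists (X t).
by rewrite probability_setT fsbig1 ?lte01// leNgt lte01.
Qed.

Lemma measurable_occupied X Y (k : 'I_m) : slot_variable X -> slot_variable Y ->
  measurable [set t | (X t <= k <= Y t)%N]%classic.
Proof.
move=> mX mY.
have -> : [set t | (X t <= k <= Y t)%N]%classic =
    (\bigcup_(p in [set p : 'I_m * 'I_m | (p.1 <= k <= p.2)%N])
       (X @^-1` [set p.1] `&` Y @^-1` [set p.2]))%classic.
  apply/seteqP; split=> [t XkY|t [[p q] /= pkq [/= -> ->]]] //.
  by exists (X t, Y t).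
apply: fin_bigcup_measurable => [|p _]; first exact: finite_finset.
by apply: measurableI; [exact: mX|exact: mY].
Qed.

End SlotVariables.

Section Occupation.
Context d (Omega : measurableType d) (R : realType) (P : probability Omega R).
Variables (n m : nat) (s e : 'I_n -> Omega -> 'I_m).
Hypothesis s_var : forall i, slot_variable (s i).
Hypothesis e_var : forall i, slot_variable (e i).

Let supp_s i : slot_support P (s i) != finset.set0.
Proof. exact: slot_support_neq0. Qed.

Let supp_e i : slot_support P (e i) != finset.set0.
Proof. exact: slot_support_neq0. Qed.

Lemma latest_ltn i : (latest P e i < m)%N.
Proof. by have [k _ kE] := max_slot_mem (supp_e i); rewrite /latest -kE. Qed.

Lemma occupation_gt0 i k : independent_slots P (s i) (e i) ->
  k \in possible_range P s e i -> 0 < occupation P s e i k.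
Proof.
move=> ind; rewrite finset.inE /earliest /latest.
have [a aS <-] := min_slot_mem (supp_s i).
have [b bE <-] := max_slot_mem (supp_e i) => /andP[ak kb].
have mO := measurable_occupied k (s_var i) (e_var i).
rewrite fine_gt0 //; apply/andP; split; last first.
  by rewrite ltey_eq fin_num_measure.
have mab : measurable ((s i @^-1` [set a]) `&` (e i @^-1` [set b]))%classic.
  by apply: measurableI; [exact: s_var|exact: e_var].
apply: (@lt_le_trans _ _ (P (s i @^-1` [set a] `&` e i @^-1` [set b])%classic)).
  by rewrite ind mule_gt0 //; [move: aS|move: bE]; rewrite finset.inE.
by apply: le_measure; rewrite ?inE // => t [/= -> ->]; rewrite ak kb.
Qed.

Lemma occupation_ge0 i k : 0 <= occupation P s e i k.
Proof. by rewrite fine_ge0 // measure_ge0. Qed.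

Lemma pessimistic_clique_cover (J : {set 'I_m}) :
  (forall i, exists2 k, k \in J & k \in possible_range P s e i) ->
  clique_cover (pessimistic_graph P s e) [set slot_clique P s e k | k in J]%SET.
Proof.
move=> hitJ; apply/andP; split.
  apply/forall_inP => _ /imsetP[k kJ ->].
  apply/forall_inP => i; rewrite finset.inE => ki.
  apply/forall_inP => j; rewrite finset.inE => kj.
  apply/implyP => neq_ij; rewrite /pessimistic_graph neq_ij /=.
  by apply/finset.set0Pn; exists k; rewrite finset.in_setI ki.
apply/eqP/setP => i; rewrite finset.in_setT; apply/bigcupP.
have [k kJ ki] := hitJ i.
by exists (slot_clique P s e k); rewrite ?imset_f // finset.inE.
Qed.

Lemma exists_minimum_slot_cover :
  (forall i, (earliest P s i <= latest P e i)%N) ->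
  exists J : {set 'I_m},
    minimum_clique_cover (pessimistic_graph P s e)
      [set slot_clique P s e k | k in J]%SET /\
    #|J| = independence_number (pessimistic_graph P s e).
Proof.
move=> el; set G := pessimistic_graph P s e.
have [A [_ disjA covA]] := greedy_intervals [set: 'I_n]%SET el.
have indA : independent G A.
  apply/forall_inP => i iA; apply/forall_inP => j jA.
  apply/negP => /andP[neq_ij /finset.set0Pn[k]].
  rewrite finset.in_setI !finset.inE => /andP[/andP[ik ki] /andP[jk kj]].
  case/orP: (disjA i j iA jA neq_ij) => lt.
    by have := leq_trans lt (leq_trans jk ki); rewrite ltnn.
  by have := leq_trans lt (leq_trans ik kj); rewrite ltnn.
pose last_slot i := Ordinal (latest_ltn i).
pose J := [set last_slot i | i in A]%SET.
have covJ : clique_cover G [set slot_clique P s e k | k in J]%SET.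
  apply: pessimistic_clique_cover => i.
  have [j jA ij] := covA i (finset.in_setT i).
  by exists (last_slot j); rewrite ?imset_f // finset.inE.
have leJA : (#|J| <= #|A|)%N by exact: leq_imset_card.
have leA : (#|A| <= independence_number G)%N by apply: (leq_bigmax_cond A).
have le_cover D : clique_cover G D -> (independence_number G <= #|D|)%N.
  by move=> covD; apply/bigmax_leqP => B /leq_independent_clique_cover; apply.
have leJ := leq_trans leJA leA.
have leCJ := leq_imset_card (slot_clique P s e) J.
exists J; split; last first.
  by apply/eqP; rewrite eqn_leq leJ (leq_trans (le_cover _ covJ)).
rewrite /minimum_clique_cover covJ; apply/forall_inP => D /le_cover.
exact/leq_trans/(leq_trans leCJ).
Qed.

Lemma min_occupation_gt0 (k_ : 'I_n -> 'I_m) :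
  (forall i, 0 < occupation P s e i (k_ i)) -> 0 < min_occupation P s e k_.
Proof. by move=> occ_gt0; apply: lt_bigmin. Qed.

Lemma lp_feasible_sum_occupation (J : {set 'I_m}) (k_ : 'I_n -> 'I_m) x :
  (forall i, k_ i \in J) -> lp_feasible P s e x ->
  \sum_(i < n) occupation P s e i (k_ i) * x i <= #|J|%:R.
Proof.
move=> kJ [xle1 x_ge0].
rewrite (partition_big k_ (mem J)) //= -sum1_card natr_sum.
apply: ler_sum => k _; apply: le_trans (xle1 k).
rewrite [leRHS](bigID (fun i => k_ i == k)) /=.
rewrite (eq_bigr (fun i => occupation P s e i k * x i)); last by move=> i /eqP ->.
rewrite lerDl sumr_ge0 // => i _.
by rewrite mulr_ge0 ?occupation_ge0.
Qed.

Lemma lp_value_le (J : {set 'I_m}) (k_ : 'I_n -> 'I_m) w :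
  (forall i, w i = 1) -> (forall i, k_ i \in J) ->
  0 < min_occupation P s e k_ ->
  (lp_value P s e w <= ((min_occupation P s e k_)^-1 * #|J|%:R)%:E)%E.
Proof.
move=> w1 kJ mu_gt0; apply: ge_ereal_sup => _ [x feas <-]; rewrite lee_fin.
rewrite ler_pdivlMl //; apply: le_trans (lp_feasible_sum_occupation kJ feas).
rewrite mulr_sumr; apply: ler_sum => i _; rewrite w1 mul1r.
by apply: ler_wpM2r; [exact: feas.2|exact: bigmin_le].
Qed.

End Occupation.

Theorem mainTheorem8 (d : measure_display) (Omega : measurableType d)
    (R : realType) (P : probability Omega R) (n m : nat)
    (s e : 'I_n -> Omega -> 'I_m) (w : 'I_n -> R)
    (s_var : forall i, slot_variable (s i))
    (e_var : forall i, slot_variable (e i))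
    (se_indep : forall i, independent_slots P (s i) (e i))
    (se_le : forall i,
      (max_slot (slot_support P (s i)) <= min_slot (slot_support P (e i)))%N)
    (w1 : forall i, w i = 1) :
  let G := pessimistic_graph P s e in
  let range_of := possible_range P s e in
  let min_cover (J : {set 'I_m}) :=
    minimum_clique_cover G [set slot_clique P s e k | k in J]%SET /\
    #|J| = independence_number G in
  (exists J : {set 'I_m}, min_cover J) /\
  (forall J : {set 'I_m}, min_cover J ->
   forall k_ : 'I_n -> 'I_m,
     (forall i, k_ i \in J /\ k_ i \in range_of i) ->
     0 < min_occupation P s e k_ /\
     (lp_value P s e w <=
      ((min_occupation P s e k_)^-1 * (independence_number G)%:R)%:E)%E).
Proof.
move=> G range_of min_cover; split.
  apply: exists_minimum_slot_cover => // i.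
  have [a aS aE] := max_slot_mem (slot_support_neq0 P (s_var i)).
  have [b bE bM] := max_slot_mem (slot_support_neq0 P (e_var i)).
  apply: leq_trans (min_slot_le aS) _; rewrite aE.
  by apply: leq_trans (se_le i) _; rewrite /latest -bM min_slot_le.
move=> J [_ cardJ] k_ kJ.
have mu_gt0 : 0 < min_occupation P s e k_.
  apply: min_occupation_gt0 => i.
  by apply: occupation_gt0 => //; have [] := kJ i.
split=> //; rewrite -cardJ; apply: lp_value_le => // i.
by have [] := kJ i.
Qed.
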